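(* Let $L$ be a slowly varying function such that $$\int_{x_0}^{\infty}L(x)\,e^{-\sqrt{\log x}}\,\frac{dx}{x}<\infty\qquad\text{and}\qquad \log x=O(L(x))\quad(x\to\infty),$$ and put $\tilde L(x)=L(x)/\log x$. Let $h:[2,\infty)\to(0,\infty)$ be continuous and non-decreasing, and suppose that the function $$x\mapsto \frac1x\sum_{n\le x}\ \sum_{p^{\nu}\| n}\nu\,h(p)$$ belongs to the de Haan class $\Pi_{\tilde L}$ with $\tilde L$-index $1$. Then $$h(x)\sim L(x)\qquad(x\to\infty).$$
   Context: A slowly varying function $L$ is a positive, continuous function defined for $x\ge x_0$ (for some $x_0>0$, which may be taken larger than $1$) satisfying $\lim_{x\to\infty}L(cx)/L(x)=1$ for every $c>0$. For a slowly varying function $\ell$, the de Haan class $\Pi_{\ell}$ consists of the measurable functions $g$ for which there is a constant $c$ (called the $\ell$-index of $g$) such that $$\lim_{x\to\infty}\frac{g(\lambda x)-g(x)}{\ell(x)}=c\log\lambda\qquad\text{for all }\lambda>0.$$ The letter $p$ denotes primes; $p^{\nu}\|n$ means that $p^{\nu}$ divides $n$ but $p^{\nu+1}$ does not, and the inner sum runs over all prime powers $p^\nu$ with $\nu\ge1$ and $p^\nu\|n$ (it is $0$ for $n=1$). *)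

(* Defs.v *)
From HB Require Import structures.
From mathcomp Require Import all_boot all_order all_algebra.
From mathcomp Require Import all_classical all_reals all_analysis.

Set Implicit Arguments.
Unset Strict Implicit.
Unset Printing Implicit Defensive.

Import Order.TTheory GRing.Theory Num.Theory.
Import numFieldNormedType.Exports.

Local Open Scope classical_set_scope.
Local Open Scope ring_scope.

(* Lets the Landau notations =O_ and ~_ be used at +oo. *)
Canonical pinfty_nbhs_filter_on (R : realType) : filter_on R :=
  FilterType (pinfty_nbhs R) (@proper_pinfty_nbhs R).

(* A function given on [x0, +oo[ is represented by a total function whose
   values below x0 are left unconstrained. *)
Definition slowly_varying (R : realType) (x0 : R) (L : R -> R) : Prop :=
  [/\ 0 < x0,
      {in `[x0, +oo[, forall x, 0 < L x},
      {within `[x0, +oo[, continuous L} &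
      forall c : R, 0 < c -> L (c * x) / L x @[x --> +oo] --> (1 : R)].

(* g, regarded as a function on ]0, +oo[, belongs to the de Haan class
   Pi_ell and its ell-index is c.  Only the values of ell near +oo matter;
   that ell is slowly varying is not repeated here. *)
Definition de_Haan_Pi (R : realType) (ell : R -> R) (c : R) (g : R -> R) :
    Prop :=
  measurable_fun (`]0, +oo[ : set R) g /\
  forall lambda : R, 0 < lambda ->
    (g (lambda * x) - g x) / ell x @[x --> +oo] --> c * ln lambda.

Definition exactly_divides (p nu n : nat) : bool :=
  (p ^ nu %| n)%N && ~~ (p ^ nu.+1 %| n)%N.

(* The sum over prime powers p ^ nu || n with nu >= 1.  For n >= 1 the bounds
   p <= n and nu <= n exclude nothing, since p ^ nu %| n forces
   p <= p ^ nu <= n and nu < p ^ nu <= n. *)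
Definition prime_power_sum (R : realType) (h : R -> R) (n : nat) : R :=
  \sum_(1 <= p < n.+1 | prime p)
    \sum_(1 <= nu < n.+1 | exactly_divides p nu n) nu%:R * h p%:R.

Definition mean_prime_power_sum (R : realType) (h : R -> R) (x : R) : R :=
  x^-1 * \sum_(1 <= n < (Num.truncn x).+1) prime_power_sum h n.

(* Main.v *)
Require Import Defs.
From HB Require Import structures.
From mathcomp Require Import all_boot all_order all_algebra.
From mathcomp Require Import all_classical all_reals all_analysis.
From mathcomp Require Import ring lra zify.

(* Let g be the mean of the theorem, D q = floor(N x / q) / (N x) - floor(x / q) / x
   for an integer N >= 1, so that g (N x) - g x is the sum of h p * D (p ^ k) over
   the prime powers.  Since N is an integer, 0 <= D q, and D q <= 1 / q, 1 / x.
   For h = ln the sum is ln N + O(1), by Legendre's formula for n!.  As h is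
   non-decreasing, comparing the weight h with ln gives, with an absolute
   constant C,
     h x * (ln N - C) / ln (N x) <= g (N x) - g x <= h (N x) * (ln N + C) / ln x:
   on the left keep only the primes in ]x, N x], the others contributing O(1)
   to the sum for ln by Chebyshev's bound; on the right use
   ln x = ln p + ln (x / p), the primes p <= x having a total of ln (x / p) of
   O(x).  Dividing by L x / ln x and letting first x, then N, tend to infinity
   yields h ~ L; O(1) errors suffice because N is arbitrary, so neither the
   prime number theorem nor its error term is needed. *)

Set Implicit Arguments.
Unset Strict Implicit.
Unset Printing Implicit Defensive.

Import Order.TTheory GRing.Theory Num.Theory.
Import numFieldNormedType.Exports.

Local Open Scope classical_set_scope.
Local Open Scope ring_scope.

(** * Multiplicities of primes and Legendre's formula for factorials *)

Lemma ltn_prime_expl (p k : nat) : prime p -> (k < p ^ k)%N.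
Proof. by move=> pp; apply: ltn_expl; exact: prime_gt1. Qed.

(** Exponents beyond [n] add nothing, since [k < p ^ k]. The free bound [M] makes the range of [k]
    independent of [n], so that sums over [n] and [k] can be exchanged. *)
Lemma logn_sum_dvdn (p n M : nat) : prime p -> (0 < n)%N -> (n <= M)%N ->
  logn p n = (\sum_(1 <= k < M.+1) (p ^ k %| n))%N.
Proof.
move=> pp n0 nM; rewrite logn_count_dvd // (@big_cat_nat _ _ _ n 1 M.+1) //=; last lia.
rewrite [X in (_ + X)%N]big_nat_cond [X in (_ + X)%N]big1 ?addn0 // => k.
rewrite andbT => /andP[nk _]; apply/eqP; rewrite eqb0.
apply/negP => /(dvdn_leq n0); have := ltn_prime_expl k pp; lia.
Qed.

Section MultiplicitySums.
Context {R : realType}.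
Implicit Types (w : nat -> R) (h : R -> R) (p k n m M : nat).

Lemma sum_exactly_divides p n : prime p -> (0 < n)%N ->
  \sum_(1 <= nu < n.+1 | exactly_divides p nu n) nu%:R = (logn p n)%:R :> R.
Proof.
move=> pp n0.
have E nu : exactly_divides p nu n = (nu == logn p n).
  by rewrite /exactly_divides !pfactor_dvdn // -leqNgt -eqn_leq.
rewrite (eq_bigl _ _ E); case: (posnP (logn p n)) => l0.
  rewrite l0 big_nat_cond big1 // => i /andP[/andP[]]; lia.
rewrite (big_rem (logn p n)) /=; last first.
  rewrite mem_index_iota l0 /=; exact: leq_trans (ltn_logl _ n0) _.
rewrite eqxx big_seq_cond big1 ?addr0 // => i /andP[].
rewrite mem_rem_uniq ?iota_uniq // inE => /andP[/negPf -> _] //.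
Qed.

Lemma prime_power_sumE h n M : (0 < n)%N -> (n <= M)%N ->
  prime_power_sum h n =
    \sum_(1 <= p < M.+1 | prime p) h p%:R * (logn p n)%:R.
Proof.
move=> n0 nM; rewrite /prime_power_sum.
rewrite (@big_cat_nat _ _ _ n.+1 1 M.+1) //=.
rewrite [X in _ = _ + X]big_nat_cond [X in _ = _ + X]big1 ?addr0; last first.
  by move=> p /andP[/andP[np _] _]; rewrite ltn_log0 // mulr0.
by apply: eq_bigr => p pp; rewrite -mulr_suml sum_exactly_divides // mulrC.
Qed.

(** Weighted Legendre formula: [p ^ k] divides [m %/ p ^ k] of the integers from 1 to [m]. A common
    [M] lets the sums for [x] and [N x] be subtracted termwise. *)
Lemma sum_prime_power_sum h m M : (m <= M)%N ->
  \sum_(1 <= n < m.+1) prime_power_sum h n =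
  \sum_(1 <= p < M.+1 | prime p) \sum_(1 <= k < M.+1)
    h p%:R * (m %/ p ^ k)%:R.
Proof.
move=> mM.
under eq_big_nat => n /andP[n0 nm].
  rewrite (@prime_power_sumE h n M) //; last lia.
  over.
rewrite exchange_big /=; apply: eq_bigr => p pp.
rewrite -!mulr_sumr; congr (_ * _); rewrite -!natr_sum; congr (_ %:R).
under eq_big_nat => n /andP[n0 nm].
  rewrite (@logn_sum_dvdn p n M) //; last lia.
  over.
by rewrite exchange_big /=; apply: eq_bigr => k _; rewrite divn_count_dvd.
Qed.

Lemma prime_power_sum_ln n : (0 < n)%N -> prime_power_sum (@ln R) n = ln n%:R.
Proof.
move=> n0; rewrite (@prime_power_sumE _ n n) //.
have np p : prime p -> (p ^ logn p n)%:R \is @Num.pos R.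
  by move=> pp; rewrite posrE ltr0n expn_gt0 prime_gt0.
(* The index 0 and all nonprime indices give the factor 1, so the factorisation of [n] becomes a
   product over primes. *)
rewrite -[in RHS](partnT n0) /partn big_ltn //= [logn 0 n]lognE expn0 mul1n.
rewrite [in RHS](eq_bigr (fun p => (if prime p then p ^ logn p n else 1)%N)); last first.
  by move=> p _; case: ifP => //; rewrite lognE => ->.
rewrite -big_mkcond /=.
elim: (index_iota 1 n.+1) => [|p s IH]; first by rewrite !big_nil ln1.
rewrite !big_cons; case: ifP => pp //; rewrite IH natrM lnM //; last first.
- rewrite posrE ltr0n; apply: prodn_cond_gt0 => q qq.
  by rewrite expn_gt0 prime_gt0.
- exact: np.
by rewrite natrX lnXn ?ltr0n ?prime_gt0 // mulr_natr.
Qed.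

Lemma sum_ln_fact m : \sum_(1 <= n < m.+1) ln n%:R = ln m`!%:R :> R.
Proof.
elim: m => [|m IH]; first by rewrite big_geq // fact0 ln1.
rewrite big_nat_recr //= IH factS natrM lnM ?posrE ?ltr0n ?fact_gt0 //.
by rewrite addrC.
Qed.

Lemma sum_prime_power_sum_ln m :
  \sum_(1 <= n < m.+1) prime_power_sum (@ln R) n = ln m`!%:R.
Proof.
rewrite -sum_ln_fact; apply: eq_big_nat => n /andP[n0 _].
exact: prime_power_sum_ln.
Qed.

(* n! >= x^n / e^x is one term of the exponential series. *)
Lemma ln_fact_ge (x : R) n : 0 < x -> n%:R * ln x - x <= ln n`!%:R.
Proof.
move=> x0; have f0 : 0 < n`!%:R :> R by rewrite ltr0n fact_gt0.
case: n f0 => [|n] f0.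
  by rewrite mul0r fact0 ln1 sub0r oppr_le0 ltW.
have := expR_ge1Dxn n (ltW x0).
move=> /(le_trans (_ : x ^+ n.+1 / n.+1`!%:R <= _)) => /(_ (ltac:(by rewrite lerDr))).
rewrite -[X in X <= _]lnK ?posrE ?divr_gt0 ?exprn_gt0 // ler_expR.
rewrite ln_div ?posrE ?exprn_gt0 // lnXn // -mulr_natl; lra.
Qed.

Lemma ln_fact_le (x : R) n : 1 <= x -> n%:R <= x -> ln n`!%:R <= n%:R * ln x.
Proof.
move=> x1; elim: n => [|n IH] nx; first by rewrite fact0 ln1 mul0r.
rewrite factS natrM lnM ?posrE ?ltr0n ?fact_gt0 // -addn1 natrD mulrDl mul1r.
rewrite addrC; apply: lerD; last by rewrite natr1 ler_ln ?posrE //; lra.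
by apply: IH; rewrite -addn1 natrD in nx; lra.
Qed.

End MultiplicitySums.

(** A weak Stirling formula for the factorial of the integer part [m] of [y]. The loss of 2 is 1
    from the subtracted term in [ln_fact_ge] and 1 from replacing [m] by [y], using [ln y <= y]. *)
Lemma mean_prime_power_sum_ln_bounds (R : realType) (y : R) : 1 <= y ->
  ln y - 2 <= mean_prime_power_sum (@ln R) y <= ln y.
Proof.
move=> y1; have y0 : 0 < y by lra.
rewrite /mean_prime_power_sum sum_prime_power_sum_ln.
have /andP[] := truncn_itv (ltW y0); set m := Num.truncn y => my ym.
have ly0 := ln_ge0 y1; have lyy := ln_sublinear y0.
have lb := ln_fact_ge m y0; have ub := ln_fact_le y1 my.
have mly : m%:R * ln y <= y * ln y by rewrite ler_wpM2r.
have mly' : y * ln y - ln y <= m%:R * ln y.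
  by rewrite -natr1 in ym; nra.
rewrite mulrC ler_pdivlMr // ler_pdivrMr //; apply/andP; split; nra.
Qed.

(** * Convergent sums over prime powers with exponent at least 2 *)

Lemma ln2_ge_half (R : realType) : 2^-1 <= ln 2 :> R.
Proof.
have := @le_ln1Dx R (- 2^-1) (ltac:(lra)).
rewrite (_ : 1 + - 2^-1 = 2^-1 :> R); last by field.
by rewrite lnV ?posrE //; lra.
Qed.

Section HigherPowers.
Context {R : realType}.
Implicit Types (p k K M : nat).

(** The right side is the exact partial sum at [r = 1/2]; keeping it, and not only its limit 4, lets
    the induction close. *)
Lemma arith_geom_le (r : R) K : 0 <= r -> r <= 2^-1 ->
  \sum_(k < K) k.+1%:R * r ^+ k <= 4 - (2 * K%:R + 4) * 2^-1 ^+ K.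
Proof.
move=> r0 r2; elim: K => [|K IH]; first by rewrite big_ord0 expr0; lra.
rewrite big_ord_recr /=.
have := lerXn2r K (_ : r \in Num.nneg) (_ : 2^-1 \in Num.nneg) r2.
rewrite !nnegrE => /(_ r0 (ltac:(lra))) rk.
have := ler_wpM2l (ler0n R K.+1) rk; rewrite exprS -natr1.
move: IH; set S := \sum_(_ < _) _; set a := 2^-1 ^+ K; set b := r ^+ K.
set k := K%:R => IH kb.
have -> : (2 * (k + 1) + 4) * (2^-1 * a) = (2 * k + 4) * a - (k + 1) * a by field.
lra.
Qed.

(** After factoring out [1 / p ^ 2], the rest is at most 4 by [arith_geom_le]. The denominator is
    relaxed to [p * (p - 1)] to match [sum_ln_sq_le]. *)
Lemma prime_tail_le p K : (2 <= p)%N ->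
  \sum_(2 <= k < K) k.-1%:R / (p ^ k)%:R <= 4 / (p%:R * p.-1%:R) :> R.
Proof.
move=> p2; have p2R : 2 <= p%:R :> R by rewrite ler_nat.
have p1R : p.-1%:R = p%:R - 1 :> R by rewrite -subn1 natrB //; lia.
have pi0 : 0 < p%:R^-1 :> R by rewrite invr_gt0; lra.
rewrite 2!big_add1 big_mkord /=.
rewrite (eq_bigr (fun k : 'I__ => p%:R^-1 ^+ 2 * (k.+1%:R * p%:R^-1 ^+ k))); last first.
  move=> k _; rewrite natrX -exprVn -addn2 exprD; ring.
rewrite -mulr_sumr; set K' := K.-2.
have h := @arith_geom_le p%:R^-1 K' (ltW pi0).
have /h {}h : p%:R^-1 <= 2^-1 :> R by rewrite lef_pV2 ?posrE //; lra.
have h4 : \sum_(k < K') k.+1%:R * p%:R^-1 ^+ k <= 4 :> R.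
  apply: le_trans h _; rewrite gerBl; apply: mulr_ge0.
    by have := ler0n R K'; lra.
  by apply: exprn_ge0; lra.
apply: le_trans (_ : p%:R^-1 ^+ 2 * 4 <= _).
  by rewrite ler_wpM2l // exprn_ge0 // ltW.
rewrite mulrC ler_wpM2l //.
rewrite exprVn lef_pV2 ?posrE ?mulr_gt0 ?exprn_gt0 ?p1R //; lra.
Qed.

(* (ln t + 2) / t is, up to lower order terms, a primitive of - ln t / t ^ 2. *)
Lemma sum_ln_sq_le M :
  \sum_(2 <= n < M.+1) ln n%:R / (n%:R * n.-1%:R) <= 2 :> R.
Proof.
case: M => [|M]; first by rewrite big_geq.
suff : \sum_(2 <= n < M.+2) ln n%:R / (n%:R * n.-1%:R)
    <= 2 - (ln M.+1%:R + 2) / M.+1%:R :> R.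
  move=> /le_trans; apply; rewrite gerBl divr_ge0 // addr_ge0 //.
  by apply: ln_ge0; rewrite ler1n.
elim: M => [|M IH]; first by rewrite big_geq // ln1 add0r divr1 subrr.
rewrite big_nat_recr //=.
apply: le_trans (lerD IH (lexx _)) _.
have t0 : 0 < M.+1%:R :> R by rewrite ltr0n.
rewrite -[M.+2%:R]natr1; set t := M.+1%:R in t0 *.
have t1 : 1 <= t by rewrite /t ler1n.
have ti0 : 0 < t^-1 by rewrite invr_gt0.
have /le_ln1Dx : -1 < t^-1 by apply: lt_trans ti0; lra.
rewrite (_ : 1 + t^-1 = (t + 1) / t); last by field; lra.
rewrite ln_div ?posrE; try lra.
set a := ln (t + 1); set b := ln t => ab.
rewrite -subr_ge0.
have -> : 2 - (a + 2) / (t + 1) - (2 - (b + 2) / t + a / ((t + 1) * t))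
  = (2 - (t + 1) * (a - b)) / (t * (t + 1)) by field; lra.
apply: divr_ge0; last by apply: mulr_ge0; lra.
(* As [t >= 1], the right side is at most 2, which is the constant added to [ln] in the approximate
   primitive. *)
have : (t + 1) * (a - b) <= (t + 1) / t by rewrite ler_wpM2l //; lra.
have -> : (t + 1) / t = 1 + t^-1 by field; lra.
have ti1 : t^-1 <= 1 by rewrite invf_le1.
by clearbody t; lra.
Qed.

(** The constant is [4 * 2], the primes being enlarged to all integers from 2 on. The weight [k - 1]
    is at least 1 and at least [k / 2], so this bound serves both for sums weighted by [ln p] and
    for unweighted sums multiplied by [ln x]. *)
Lemma sum_higher_powers_le M :
  \sum_(1 <= p < M.+1 | prime p) \sum_(2 <= k < M.+1)
    ln p%:R * (k.-1%:R / (p ^ k)%:R) <= 8 :> R.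
Proof.
have nn n : 0 <= ln n.+1%:R / (n.+1%:R * n%:R) :> R.
  by rewrite divr_ge0 ?ln_ge0 ?ler1n // mulr_ge0.
apply: le_trans (_ : \sum_(1 <= p < M.+1 | prime p)
   4 * (ln p%:R / (p%:R * p.-1%:R)) <= _).
  rewrite big_seq_cond [leRHS]big_seq_cond; apply: ler_sum => p /andP[_ pp].
  rewrite -mulr_sumr [leRHS]mulrCA; apply: ler_wpM2l.
    by apply: ln_ge0; rewrite ler1n prime_gt0.
  by apply: prime_tail_le; exact: prime_gt1.
rewrite -mulr_sumr (_ : 8 = 4 * 2 :> R); last by ring.
rewrite ler_wpM2l // big_mkcond /=.
case: M => [|M]; first by rewrite big_geq.
rewrite big_ltn //= add0r; apply: le_trans (@sum_ln_sq_le M.+1).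
rewrite big_nat_cond [leRHS]big_nat_cond; apply: ler_sum => -[|n] // _.
by case: ifP.
Qed.

End HigherPowers.

(** * Floor increments summed over primes and prime powers *)

Lemma ler_sum_prime (R : realType) (a b : nat) (F G : nat -> R) :
  (forall p, prime p -> (a <= p < b)%N -> F p <= G p) ->
  \sum_(a <= p < b | prime p) F p <= \sum_(a <= p < b | prime p) G p.
Proof.
move=> FG; rewrite big_nat_cond [leRHS]big_nat_cond; apply: ler_sum => p.
by move=> /andP[] /[swap]; exact: FG.
Qed.

Lemma sum_split_powers (R : realType) (M : nat) (F : nat -> nat -> R) :
  \sum_(1 <= p < M.+1 | prime p) \sum_(1 <= k < M.+1) F p k =
  \sum_(1 <= p < M.+1 | prime p) F p 1%N +
  \sum_(1 <= p < M.+1 | prime p) \sum_(2 <= k < M.+1) F p k.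
Proof.
rewrite -big_split /=; rewrite big_nat_cond [RHS]big_nat_cond.
by apply: eq_bigr => p /andP[/andP[p1 pM] _]; rewrite big_ltn //; lia.
Qed.

Definition floor_incr (R : realType) (N : nat) (x : R) (q : nat) : R :=
  (Num.truncn (N%:R * x) %/ q)%:R / (N%:R * x) - (Num.truncn x %/ q)%:R / x.

Section FloorIncrements.
Context {R : realType}.
Variables (N : nat) (x : R).
Hypotheses (N1 : (1 <= N)%N) (x1 : 1 <= x).

Let m := Num.truncn x.
Let M := Num.truncn (N%:R * x).
Let D := floor_incr N x.

Let x0 : 0 < x. Proof. exact: lt_le_trans ltr01 x1. Qed.
Let N1R : 1 <= N%:R :> R. Proof. by rewrite ler1n. Qed.
Let Nx0 : 0 < N%:R * x. Proof. by rewrite mulr_gt0 // ltr0n. Qed.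
Let m_le : m%:R <= x. Proof. by rewrite truncn_le ltW. Qed.
Let M_le : M%:R <= N%:R * x. Proof. by rewrite truncn_le ltW. Qed.
Let lt_m : x < m%:R + 1. Proof. by rewrite natr1 truncnS_gt. Qed.

Lemma mul_truncn_le : (N * m <= M)%N.
Proof. by rewrite truncn_ge_nat ?(ltW Nx0) // natrM ler_pM2l // ltr0n. Qed.

Lemma truncn_le_mul : (m <= M)%N.
Proof. by apply: leq_trans mul_truncn_le; rewrite leq_pmull. Qed.

Lemma mean_incrE (h : R -> R) :
  mean_prime_power_sum h (N%:R * x) - mean_prime_power_sum h x =
  \sum_(1 <= p < M.+1 | prime p) \sum_(1 <= k < M.+1) h p%:R * D (p ^ k)%N.
Proof.
rewrite /mean_prime_power_sum -/m -/M (sum_prime_power_sum h (leqnn M)).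
rewrite (sum_prime_power_sum h truncn_le_mul).
rewrite !mulr_sumr -sumrB; apply: eq_bigr => p _.
rewrite !mulr_sumr -sumrB; apply: eq_bigr => k _.
by rewrite /D /floor_incr -/m -/M; ring.
Qed.

(* This is where N has to be an integer. *)
Lemma floor_incr_ge0 q : 0 <= D q.
Proof.
rewrite /D /floor_incr -/m -/M subr_ge0 invfM mulrA ler_wpM2r ?invr_ge0 ?(ltW x0) //.
rewrite ler_pdivlMr ?ltr0n // -natrM ler_nat mulnC.
case: (posnP q) => [->|q0]; first by rewrite !divn0 muln0.
rewrite leq_divRL // -mulnA; apply: leq_trans mul_truncn_le.
by rewrite leq_mul2l leq_trunc_div orbT.
Qed.

Lemma floor_incr_gtE q : (m < q)%N -> D q = (M %/ q)%:R / (N%:R * x).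
Proof. by move=> mq; rewrite /D /floor_incr -/m -/M [(m %/ q)%N]divn_small // mul0r subr0. Qed.

Let divn_M_le q : (0 < q)%N -> (M %/ q)%:R / (N%:R * x) <= q%:R^-1 :> R.
Proof.
move=> q0; rewrite ler_pdivrMr // mulrC ler_pdivlMr ?ltr0n // -natrM.
by apply: le_trans M_le; rewrite ler_nat leq_trunc_div.
Qed.

Lemma floor_incr_le_inv q : (0 < q)%N -> D q <= q%:R^-1.
Proof.
move=> q0; rewrite /D /floor_incr -/m -/M lerBlDr.
apply: le_trans (divn_M_le q0) _; rewrite lerDl divr_ge0 ?(ltW x0) //.
Qed.

(** The increment is at most [1 / q - floor (x / q) / x], which is the fractional part of [x / q]
    divided by [x]. *)
Lemma floor_incr_le_invx q : (0 < q)%N -> D q <= x^-1.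
Proof.
move=> q0; rewrite /D /floor_incr -/m -/M lerBlDr.
apply: le_trans (divn_M_le q0) _.
rewrite -{1}[x^-1]mul1r -mulrDl ler_pdivlMr // mulrC ler_pdivrMr ?ltr0n //.
apply: ltW; apply: lt_le_trans lt_m _.
by rewrite !natr1 nat1r -natrM ler_nat ltn_ceil.
Qed.

Lemma sum_floor_incr_ln_bounds :
  ln N%:R - 2 <= \sum_(1 <= p < M.+1 | prime p) \sum_(1 <= k < M.+1)
    ln p%:R * D (p ^ k)%N <= ln N%:R + 2.
Proof.
rewrite -(mean_incrE (@ln R)).
have y1 : 1 <= N%:R * x by rewrite mulr_ege1.
have := mean_prime_power_sum_ln_bounds x1.
have := mean_prime_power_sum_ln_bounds y1.
rewrite lnM ?posrE ?ltr0n //; lra.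
Qed.

Let lnp_ge0 p : prime p -> 0 <= ln p%:R :> R.
Proof. by move=> pp; apply: ln_ge0; rewrite ler1n prime_gt0. Qed.

Lemma sum_prime_floor_incr_ln_le :
  \sum_(1 <= p < M.+1 | prime p) ln p%:R * D p <= ln N%:R + 2 :> R.
Proof.
have /andP[_] := sum_floor_incr_ln_bounds; apply: le_trans.
rewrite sum_split_powers.
rewrite lerDl sumr_ge0 // => p pp; rewrite sumr_ge0 // => k _.
by rewrite mulr_ge0 ?lnp_ge0 ?floor_incr_ge0.
Qed.

Lemma sum_large_prime_floor_incr_ln_le :
  \sum_(m.+1 <= p < M.+1 | prime p) ln p%:R * D p <= ln N%:R + 2 :> R.
Proof.
apply: le_trans sum_prime_floor_incr_ln_le.
rewrite [leRHS](@big_cat_nat _ _ _ m.+1) //=; last exact: truncn_le_mul.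
rewrite lerDr sumr_ge0 // => p pp.
by rewrite mulr_ge0 ?lnp_ge0 ?floor_incr_ge0.
Qed.

Lemma sum_higher_floor_incr_ln_le :
  \sum_(1 <= p < M.+1 | prime p) \sum_(2 <= k < M.+1) ln p%:R * D (p ^ k)%N
    <= 8 :> R.
Proof.
apply: le_trans (@sum_higher_powers_le R M).
apply: ler_sum_prime => p pp _.
apply: ler_sum_nat => k /andP[k2 _].
rewrite ler_wpM2l ?lnp_ge0 //.
have q0 : (0 < p ^ k)%N by rewrite expn_gt0 prime_gt0.
apply: le_trans (floor_incr_le_inv q0) _.
rewrite -[leLHS]mul1r ler_wpM2r ?invr_ge0 // ler1n; lia.
Qed.

(** The terms are nonnegative, so the sum may run over all integers up to [m]; it is then [m * ln x]
    minus the logarithm of the factorial of [m], and [ln_fact_ge] applies. *)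
Lemma sum_small_prime_ln_div_le :
  \sum_(1 <= p < m.+1 | prime p) (ln x - ln p%:R) <= x.
Proof.
apply: le_trans (_ : \sum_(1 <= p < m.+1) (ln x - ln p%:R) <= _).
  rewrite [leLHS]big_mkcond; apply: ler_sum_nat => p /andP[p0 pm].
  case: ifP => // _; rewrite subr_ge0 ler_ln ?posrE ?ltr0n //.
  by apply: le_trans m_le; rewrite ler_nat.
rewrite sumrB sum_ln_fact big_const_nat iter_addr addr0 subSS subn0 -[ln x *+ _]mulr_natl.
by have := ln_fact_ge m x0; lra.
Qed.

Lemma sum_prime_floor_incr_le :
  ln x * \sum_(1 <= p < M.+1 | prime p) D p <= ln N%:R + 3.
Proof.
apply: le_trans (_ : \sum_(1 <= p < M.+1 | prime p) ln p%:R * D p +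
  x^-1 * \sum_(1 <= p < m.+1 | prime p) (ln x - ln p%:R) <= _); last first.
  rewrite (_ : ln N%:R + 3 = ln N%:R + 2 + 1); last by ring.
  rewrite lerD ?sum_prime_floor_incr_ln_le //.
  by rewrite mulrC ler_pdivrMr // mul1r sum_small_prime_ln_div_le.
have mM := truncn_le_mul.
rewrite mulr_sumr addrC -lerBlDr -sumrB.
rewrite (@big_cat_nat _ _ _ m.+1) //=.
rewrite -[leRHS]addr0; apply: lerD.
  rewrite mulr_sumr; apply: ler_sum_prime => p pp /andP[p1 pm].
  rewrite -mulrBl [leRHS]mulrC ler_wpM2l ?floor_incr_le_invx //.
  rewrite subr_ge0 ler_ln ?posrE ?ltr0n //.
  by apply: le_trans m_le; rewrite ler_nat.
(* For [p > x] the correction [ln x - ln p] is nonpositive and needs no bound on the increment. *)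
rewrite big_nat_cond; apply: sumr_le0 => p /andP[/andP[mp pM] pp].
rewrite -mulrBl; apply: mulr_le0_ge0; last exact: floor_incr_ge0.
have xp : x <= p%:R.
  by apply: ltW; apply: lt_le_trans lt_m _; rewrite natr1 ler_nat.
by rewrite subr_le0 ler_ln ?posrE //; apply: lt_le_trans xp.
Qed.

(** Split [ln x = ln (x / q) + ln q]: the first part, at most [x / q], is paired with
    [D q <= 1 / x], the second with [D q <= 1 / q]. *)
Let floor_incr_ln_le q : (0 < q)%N -> ln x * D q <= (1 + ln q%:R) / q%:R.
Proof.
move=> q0; have q0R : 0 < q%:R :> R by rewrite ltr0n.
have lq : 0 <= ln q%:R :> R by rewrite ln_ge0 // ler1n.
have lnE : ln x = ln (x / q%:R) + ln q%:R by rewrite ln_div ?posrE // subrK.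
rewrite lnE !mulrDl; apply: lerD; last by rewrite ler_wpM2l ?floor_incr_le_inv.
rewrite mul1r; apply: le_trans (_ : x / q%:R * x^-1 <= _); last first.
  by rewrite mulrAC divff ?mul1r // gt_eqF.
have xq0 : 0 < x / q%:R by rewrite divr_gt0.
apply: le_trans (_ : x / q%:R * D q <= _).
  by rewrite ler_wpM2r ?floor_incr_ge0 // ltW // ln_sublinear.
by rewrite ler_wpM2l ?floor_incr_le_invx // ltW.
Qed.

Lemma sum_higher_floor_incr_le :
  ln x * \sum_(1 <= p < M.+1 | prime p) \sum_(2 <= k < M.+1) D (p ^ k)%N
    <= 32.
Proof.
apply: le_trans (_ : 4 * \sum_(1 <= p < M.+1 | prime p) \sum_(2 <= k < M.+1)
    ln p%:R * (k.-1%:R / (p ^ k)%:R) <= _); last first.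
  by have := @sum_higher_powers_le R M; lra.
rewrite !mulr_sumr; apply: ler_sum_prime => p pp _.
rewrite !mulr_sumr; apply: ler_sum_nat => k /andP[k2 _].
have q0 : (0 < p ^ k)%N by rewrite expn_gt0 prime_gt0.
apply: le_trans (floor_incr_ln_le q0) _.
rewrite !mulrA ler_wpM2r ?invr_ge0 //.
rewrite natrX lnXn ?ltr0n ?prime_gt0 // -[_ *+ k]mulr_natl.
have := ln2_ge_half R.
have : ln 2 <= ln p%:R :> R by rewrite ler_ln ?posrE ?ltr0n ?prime_gt0 // ler_nat prime_gt1.
have -> : k.-1%:R = k%:R - 1 :> R by rewrite -subn1 natrB //; lia.
have : 2 <= k%:R :> R by rewrite ler_nat.
(* The goal is [1 + k * l <= 4 * l * (k - 1)]. Since [1 <= 2 * l], it follows from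
   [2 + k <= 4 * (k - 1)], that is, from [k >= 2]. *)
set l := ln p%:R; set a : R := k%:R => a2 l2 l2'.
have : 0 <= (a - 2) * l by apply: mulr_ge0; lra.
by clearbody l a; lra.
Qed.

Lemma sum_floor_incr_le :
  ln x * \sum_(1 <= p < M.+1 | prime p) \sum_(1 <= k < M.+1) D (p ^ k)%N
    <= ln N%:R + 35.
Proof.
rewrite sum_split_powers mulrDr.
have := sum_prime_floor_incr_le; have := sum_higher_floor_incr_le; lra.
Qed.

End FloorIncrements.

(** * Chebyshev's upper bound *)

Section Chebyshev.
Context {R : realType}.

(** Take [N = 2] and [x = m]: each prime in []m, 2m]] has increment at least [1 / (2m)], so the sum
    is at most [2m * (ln 2 + 2)], and [ln 2 <= 1]. *)
Lemma sum_prime_ln_doubling_le (m : nat) : (0 < m)%N ->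
  \sum_(m.+1 <= p < m.*2.+1 | prime p) ln p%:R <= 6 * m%:R :> R.
Proof.
move=> m0; have m1 : 1 <= m%:R :> R by rewrite ler1n.
have := @sum_large_prime_floor_incr_ln_le R 2 m%:R isT m1.
rewrite -natrM natrK mul2n natrK => H.
have ln2 : ln 2 <= 1 :> R.
  by have := @le_ln1Dx R 1 (ltac:(lra)); rewrite (_ : 1 + 1 = 2 :> R).
apply: le_trans (_ : 2 * m%:R * \sum_(m.+1 <= p < m.*2.+1 | prime p)
  ln p%:R * floor_incr 2 m%:R p <= _); last first.
  rewrite (_ : 6 * m%:R = 2 * m%:R * 3); last by ring.
  by rewrite ler_wpM2l //; lra.
rewrite mulr_sumr; apply: ler_sum_prime => p pp /andP[mp pm].
have l0 : 0 <= ln p%:R :> R by rewrite ln_ge0 // ler1n prime_gt0.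
rewrite mulrCA -[leLHS]mulr1 ler_wpM2l // (@floor_incr_gtE R) ?natrK //.
rewrite -natrM natrK mul2n mulrC divfK ?pnatr_eq0 ?double_eq0; last lia.
by rewrite ler1n divn_gt0 ?prime_gt0 //.
Qed.

Lemma sum_prime_ln_le (n : nat) :
  \sum_(1 <= p < n.+1 | prime p) ln p%:R <= 12 * n%:R :> R.
Proof.
elim/ltn_ind: n => n IH.
have [n1|n2] := leqP n 1.
  rewrite big_nat_cond big1 ?mulr_ge0 // => p /andP[] /[swap] /prime_gt1; lia.
(* Half of [n] is rounded up so that [2m] covers [n]. The induction needs
   [12 * m + 6 * m <= 12 * n], which holds for every [n >= 2], with equality at 3. *)
pose m := uphalf n; have nm : (n <= m.*2 <= n.+1)%N by rewrite /m; lia.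
have mn : (m < n)%N by rewrite /m; lia.
have m0 : (0 < m)%N by rewrite /m; lia.
have lnn p : prime p -> 0 <= ln p%:R :> R.
  by move=> pp; rewrite ln_ge0 // ler1n prime_gt0.
apply: le_trans (_ : \sum_(1 <= p < m.*2.+1 | prime p) ln p%:R <= _).
  rewrite [leRHS](@big_cat_nat _ _ _ n.+1) //=; last lia.
  by rewrite lerDl sumr_ge0.
rewrite (@big_cat_nat _ _ _ m.+1) //=; last lia.
apply: le_trans (lerD (IH _ mn) (sum_prime_ln_doubling_le m0)) _.
rewrite -mulrDl -!natrD -!natrM ler_nat; lia.
Qed.

End Chebyshev.

(** * Two-sided bounds for the increment of the mean *)

Section MeanIncrements.
Context {R : realType}.
Variables (N : nat) (x : R) (h : R -> R).
Hypotheses (N1 : (1 <= N)%N) (x2 : 2 <= x).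
Hypotheses (h_pos : {in `[2, +oo[, forall y, 0 < h y}).
Hypotheses (h_nondecr : {in `[2, +oo[ &, {homo h : y z / y <= z}}).

Let m := Num.truncn x.
Let M := Num.truncn (N%:R * x).
Let D := floor_incr N x.

Let x1 : 1 <= x. Proof. by apply: le_trans x2; rewrite ler1n. Qed.
Let x0 : 0 < x. Proof. exact: lt_le_trans ltr01 x1. Qed.
Let N0R : 0 < N%:R :> R. Proof. by rewrite ltr0n. Qed.
Let Nx0 : 0 < N%:R * x. Proof. by rewrite mulr_gt0. Qed.
Let m_le : m%:R <= x. Proof. by rewrite truncn_le ltW. Qed.
Let M_le : M%:R <= N%:R * x. Proof. by rewrite truncn_le ltW. Qed.
Let lt_m : x < m%:R + 1. Proof. by rewrite natr1 truncnS_gt. Qed.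
Let x_le : x <= N%:R * x. Proof. by rewrite ler_peMl ?(ltW x0) // ler1n. Qed.

(** From a total of at least [ln N - 2], remove at most 8 for higher powers and at most 12 for the
    primes up to [x]; the latter uses [D p <= 1 / x] and Chebyshev's bound. *)
Lemma sum_large_prime_floor_incr_ln_ge :
  ln N%:R - 22 <= \sum_(m.+1 <= p < M.+1 | prime p) ln p%:R * D p.
Proof.
have /andP[+ _] := @sum_floor_incr_ln_bounds R N x N1 x1.
rewrite sum_split_powers (@big_cat_nat _ _ _ m.+1) //=; last exact: truncn_le_mul.
have := @sum_higher_floor_incr_ln_le R N x N1 x1.
have : \sum_(1 <= p < m.+1 | prime p) ln p%:R * floor_incr N x (p ^ 1)%N <= 12.
  apply: le_trans (_ : x^-1 * (12 * x) <= _); last first.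
    by rewrite mulrCA mulVf ?mulr1 // gt_eqF.
  apply: le_trans (_ : x^-1 * (12 * m%:R) <= _); last first.
    by rewrite ler_wpM2l ?invr_ge0 ?(ltW x0) // ler_wpM2l.
  apply: le_trans (ler_wpM2l (_ : 0 <= x^-1) (@sum_prime_ln_le R m)).
    rewrite mulr_sumr; apply: ler_sum_prime => p pp _.
    rewrite mulrC expn1 ler_wpM2r //.
      by rewrite ln_ge0 // ler1n prime_gt0.
    exact/floor_incr_le_invx/prime_gt0.
  by rewrite invr_ge0 ltW.
rewrite /M /D; set a := \sum_(1 <= p < m.+1 | _) _.
set b := \sum_(_ <= _ < _ | _) _; set c := \sum_(_ <= _ < _ | _) _.
by clearbody a b c; lra.
Qed.

(** Every prime involved is at most [N x], so monotonicity replaces [h p] by [h (N x)]. *)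
Lemma mean_incr_le :
  ln x * (mean_prime_power_sum h (N%:R * x) - mean_prime_power_sum h x) <=
  h (N%:R * x) * (ln N%:R + 35).
Proof.
have hN : 0 < h (N%:R * x).
  by apply: h_pos; rewrite in_itv /= andbT (le_trans x2).
apply: le_trans (ler_wpM2l (ltW hN) (@sum_floor_incr_le R N x N1 x1)).
rewrite mulrCA ler_wpM2l ?ln_ge0 // (@mean_incrE R) // !mulr_sumr.
apply: ler_sum_prime => p pp /andP[_ pM].
rewrite mulr_sumr; apply: ler_sum_nat => k _.
rewrite ler_wpM2r ?floor_incr_ge0 //.
have p2 : 2 <= p%:R :> R by rewrite ler_nat prime_gt1.
have pN : p%:R <= N%:R * x by apply: le_trans M_le; rewrite ler_nat.
apply: h_nondecr => //; rewrite in_itv /= andbT //; exact: le_trans pN.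
Qed.

(** For [x < p <= N x], both [h x <= h p] and [ln p <= ln (N x)]. The discarded terms are
    nonnegative because [h] is positive. *)
Lemma mean_incr_ge :
  h x * (ln N%:R - 22) <=
  ln (N%:R * x) * (mean_prime_power_sum h (N%:R * x) - mean_prime_power_sum h x).
Proof.
have hx : 0 < h x by apply: h_pos; rewrite in_itv /= andbT.
have hp p : prime p -> 0 < h p%:R.
  by move=> pp; apply: h_pos; rewrite in_itv /= andbT ler_nat prime_gt1.
have lnN0 : 0 <= ln (N%:R * x) by rewrite ln_ge0 // (le_trans x1).
apply: le_trans (ler_wpM2l (ltW hx) sum_large_prime_floor_incr_ln_ge) _.
apply: le_trans (_ : ln (N%:R * x) *
  \sum_(m.+1 <= p < M.+1 | prime p) h p%:R * D p <= _).
  rewrite !mulr_sumr; apply: ler_sum_prime => p pp /andP[mp pM].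
  have xp : x <= p%:R.
    by apply: ltW; apply: lt_le_trans lt_m _; rewrite natr1 ler_nat.
  have D0 : 0 <= D p by exact: floor_incr_ge0.
  rewrite !mulrA ler_wpM2r // mulrC ler_pM ?(ltW hx) ?ln_ge0 //.
  - by apply: le_trans xp.
  - rewrite ler_ln ?posrE //; last exact: lt_le_trans xp.
    by apply: le_trans M_le; rewrite ler_nat.
  - by apply: h_nondecr => //; rewrite in_itv /= andbT // (le_trans x2).
rewrite ler_wpM2l // (@mean_incrE R) // sum_split_powers.
rewrite (@big_cat_nat _ _ _ m.+1 1) //=; last exact: truncn_le_mul.
rewrite addrAC lerDr addr_ge0 // sumr_ge0 // => p pp.
  by rewrite mulr_ge0 ?(ltW (hp _ pp)) ?floor_incr_ge0.
rewrite sumr_ge0 // => k _.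
by rewrite mulr_ge0 ?(ltW (hp _ pp)) ?floor_incr_ge0.
Qed.

End MeanIncrements.

(** * Passage to the limit *)

Lemma near_pinfty_scale (R : realType) (c : R) (P : R -> Prop) : 0 < c ->
  (\forall x \near +oo, P (c * x)) -> \forall y \near +oo, P y.
Proof.
move=> c0 [b [_ Pb]]; exists (c * b); split; first exact: num_real.
move=> y; rewrite mulrC -ltr_pdivlMr // => /Pb.
by rewrite mulrC divfK // gt_eqF.
Qed.

Lemma nat_ln_ge (R : realType) (A : R) : exists2 N, (1 <= N)%N & A <= ln N%:R.
Proof.
exists (Num.truncn (expR A)).+1 => //.
by rewrite -ler_expR lnK ?posrE ?ltr0n // ltW // truncnS_gt.
Qed.

(* Nothing forces x0 >= 1: for x < 1, Num.sqrt (ln x) is 0, so the part of the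
   integral over [x0, 1] is finite and does not affect the hypothesis. *)
Theorem mainTheorem5 (R : realType) (x0 : R) (L h : R -> R)
  (L_sv : slowly_varying x0 L)
  (L_int : (\int[lebesgue_measure]_(x in `[x0, +oo[)
              (L x * expR (- Num.sqrt (ln x)) / x)%:E < +oo)%E)
  (ln_O_L : @ln R =O_ +oo L)
  (h_pos : {in `[2, +oo[, forall x, 0 < h x})
  (h_cont : {within `[2, +oo[, continuous h})
  (h_nondecr : {in `[2, +oo[ &, {homo h : x y / x <= y}})
  (h_Pi : de_Haan_Pi (fun x => L x / ln x) 1 (mean_prime_power_sum h)) :
  h ~_ +oo L.
Proof.
have [x0_gt0 L_pos _ L_lim] := L_sv; have [_ g_lim] := h_Pi.
suff near_le (e : R) : 0 < e -> \forall x \near +oo, `|h x - L x| <= e * `|L x|.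
  exact/eqaddoP.
move=> e0.
(* This choice gives [(1 - e) * (l + 35) <= l - 1] and [l + 1 <= (1 + e) * (l - 22)] for [l = ln N],
   as needed for the lower and the upper bound. *)
have [N N1 lN] := @nat_ln_ge R (22 + 36 / e).
have e36 : 0 < 36 / e by rewrite divr_gt0.
have N0R : 0 < N%:R :> R by rewrite ltr0n.
have [l lE] : {l : R | ln N%:R = l} by exists (ln N%:R).
rewrite lE in lN.
have le36 : 36 <= e * (l - 22).
  by rewrite mulrC -ler_pdivrMr //; lra.
have {}lN : 22 < l by lra.
have Lp x : x0 <= x -> 0 < L x by move=> ?; apply: L_pos; rewrite in_itv /= andbT.
pose G x := mean_prime_power_sum h (N%:R * x) - mean_prime_power_sum h x.
(* The de Haan limit at [lambda = N], with tolerance 1/2. *)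
have Gl : \forall x \near +oo, (l - 2^-1) * L x <= G x * ln x <= (l + 2^-1) * L x.
  have := g_lim _ N0R; rewrite mul1r lE => /cvgrPdist_le /(_ 2^-1 (ltac:(by []))).
  apply: filter_app; near=> x; rewrite -/(G x).
  have Lx : 0 < L x by apply: Lp; near: x; exact: nbhs_pinfty_ge (num_real _).
  have lx : 0 < ln x by apply: ln_gt0; near: x; exact: nbhs_pinfty_gt (num_real _).
  rewrite invf_div mulrA ler_norml => /andP[H1 H2].
  rewrite -[G x * ln x](divfK (lt0r_neq0 Lx)) !ler_pM2r //.
  by apply/andP; split; lra.
have lower : \forall y \near +oo, (1 - e) * L y <= h y.
  (* [mean_incr_le] controls [h] at [N x], so the bound is proved there; slow variation then
     compares [L (N x)] with [L x]. *)
  apply: (near_pinfty_scale N0R).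
  (* The tolerance [1 / (2 * l)] is small enough that [(l - 1) * (1 + 1 / (2 * l)) <= l - 1/2]. *)
  have := L_lim _ N0R => /cvgrPdist_le /(_ (2 * l)^-1).
  have l2 : 0 < (2 * l)^-1 by rewrite invr_gt0; lra.
  move=> /(_ l2); apply: filter_app; near=> x.
  have Lx : 0 < L x by apply: Lp; near: x; exact: nbhs_pinfty_ge (num_real _).
  have x2 : 2 <= x by near: x; exact: nbhs_pinfty_ge (num_real _).
  have NxL : 0 < L (N%:R * x).
    apply: Lp; apply: le_trans (_ : x <= _); first by near: x; exact: nbhs_pinfty_ge (num_real _).
    by rewrite ler_peMl ?ler1n // (le_trans _ x2).
  have /andP[G1 _] : (l - 2^-1) * L x <= G x * ln x <= (l + 2^-1) * L x by near: x.
  rewrite ler_norml => /andP[H _].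
  have {}H : L (N%:R * x) <= (1 + (2 * l)^-1) * L x.
    by rewrite -ler_pdivrMr //; lra.
  have := mean_incr_le N1 x2 h_pos h_nondecr; rewrite -/(G x) lE mulrC => G2.
  have H1 : (l - 1) * L (N%:R * x) <= (l - 2^-1) * L x.
    apply: le_trans (ler_wpM2l (_ : 0 <= l - 1) H) _; first by lra.
    rewrite mulrA ler_wpM2r ?(ltW Lx) //.
    rewrite (_ : (l - 1) * (1 + (2 * l)^-1) = l - 2^-1 - (2 * l)^-1).
      by lra.
    by field; apply: lt0r_neq0; lra.
  have l35 : 0 < l + 35 by lra.
  rewrite -(ler_pM2r l35); apply: le_trans (le_trans H1 (le_trans G1 G2)).
  rewrite mulrAC ler_wpM2r ?(ltW NxL) //; nra.
have upper : \forall x \near +oo, h x <= (1 + e) * L x.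
  near=> x.
  have Lx : 0 < L x by apply: Lp; near: x; exact: nbhs_pinfty_ge (num_real _).
  have x2 : 2 <= x by near: x; exact: nbhs_pinfty_ge (num_real _).
  (* Since [ln (N x) = l + ln x], the lower bound for the increment brings in an extra [l * G x];
     this threshold makes it at most [L x / 2]. *)
  have lx : (2 * l + 1) * l <= ln x.
    rewrite -ler_expR lnK ?posrE; last by apply: lt_le_trans x2.
    by near: x; exact: nbhs_pinfty_ge (num_real _).
  have /andP[_ G1] : (l - 2^-1) * L x <= G x * ln x <= (l + 2^-1) * L x by near: x.
  have := mean_incr_ge N1 x2 h_pos h_nondecr; rewrite -/(G x) lE.
  rewrite lnM ?posrE ?(lt_le_trans _ x2) // lE => G2.
  have lx0 : 0 < ln x by apply: lt_le_trans lx; nra.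
  have GL : l * G x <= 2^-1 * L x.
    rewrite -(ler_pM2r lx0) -mulrA; apply: le_trans (_ : l * ((l + 2^-1) * L x) <= _).
      by rewrite ler_wpM2l //; lra.
    rewrite mulrAC mulrA ler_wpM2r ?(ltW Lx) //; lra.
  have l22 : 0 < l - 22 by lra.
  rewrite -(ler_pM2r l22); apply: le_trans G2 _; rewrite mulrDl.
  apply: le_trans (_ : (l + 1) * L x <= _).
    by rewrite [ln x * _]mulrC; lra.
  rewrite mulrAC ler_wpM2r ?(ltW Lx) //; nra.
near=> x.
have Lx : 0 < L x by apply: Lp; near: x; exact: nbhs_pinfty_ge (num_real _).
have lo : (1 - e) * L x <= h x by near: x.
have up : h x <= (1 + e) * L x by near: x.
rewrite (gtr0_norm Lx) ler_norml; apply/andP.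
by split; lra.
Unshelve. all: by end_near.
Qed.
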